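(* Let $H=\sum_{i,j=1}^n\left(\tfrac12\mu_{ij}p_ip_j+\tfrac12\kappa_{ij}q_iq_j+\tfrac12\gamma_{ij}p_iq_j+\tfrac12\gamma_{ji}q_ip_j\right)$, where $\mu,\kappa$ are real symmetric $n\times n$ matrices, $\gamma$ is a real $n\times n$ matrix, and $q_i,p_i$ are Hermitian operators with $[p_i,q_j]=-i\delta_{ij}$, $[p_i,p_j]=[q_i,q_j]=0$. Then $H$ is Dirac diagonalizable if and only if its dynamic matrix $D=\Sigma_yM$ is physically diagonalizable.
   Context: $M=\begin{pmatrix}\mu&\gamma\\ \gamma^T&\kappa\end{pmatrix}$ and $\Sigma_y=\begin{pmatrix}0&-iI_n\\ iI_n&0\end{pmatrix}$; with $\phi=(p_1,\dots,p_n,q_1,\dots,q_n)^T$ one has $H=\tfrac12\phi^\dagger M\phi$ and $[\phi_\mu,H]=\sum_\nu D_{\mu\nu}\phi_\nu$. $H$ is Dirac diagonalizable if there exist operators $d_1,\dots,d_n$, each a complex linear combination of $p_1,\dots,p_n,q_1,\dots,q_n$, satisfying $[d_i,d_j^\dagger]=\delta_{ij}$, $[d_i,d_j]=0$, and real numbers $\omega_1,\dots,\omega_n,C$ such that $H=\sum_i\omega_id_i^\dagger d_i+C$. A matrix is physically diagonalizable if it is diagonalizable over $\mathbb{C}$ and all its eigenvalues are real. *)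

(* Defs.v *)
(* mathcomp-analysis reals + real_closed complex numbers R[i]. *)
From HB Require Import structures.
From mathcomp Require Import all_boot all_order all_algebra.
From mathcomp Require Import reals.
From mathcomp.real_closed Require Export complex.
Set Implicit Arguments. Unset Strict Implicit. Unset Printing Implicit Defensive.
Import Order.TTheory GRing.Theory Num.Theory.
Local Open Scope ring_scope.
Local Open Scope complex_scope.

Section Defs.
Variable R : realType.
Local Notation C := R[i].

(* ----- abstract operator algebra: a (nontrivial) complex *-algebra ----- *)
Section OpAlg.
Variable A : algType C.

(* adj is an adjoint operation (dagger): antilinear, anti-multiplicative, involutive *)
Definition is_adjoint (adj : A -> A) : Prop :=
  [/\ forall x y : A, adj (x + y) = adj x + adj y,
      forall (c : C) (x : A), adj (c *: x) = (c^*)%C *: adj x,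
      forall x y : A, adj (x * y) = adj y * adj x &
      forall x : A, adj (adj x) = x].

Definition is_hermitian (adj : A -> A) (x : A) : Prop := adj x = x.

(* commutator [x, y] = x y - y x *)
Definition commr (x y : A) : A := x * y - y * x.

(* canonical commutation relations [p_i,q_j] = -i delta_ij, [p_i,p_j]=[q_i,q_j]=0 *)
Definition CCR (n : nat) (p q : 'I_n -> A) : Prop :=
  [/\ forall i j, commr (p i) (q j) = (if i == j then - 'i else 0) *: (1 : A),
      forall i j, commr (p i) (p j) = 0 &
      forall i j, commr (q i) (q j) = 0].

(* phi = (p_1,...,p_n,q_1,...,q_n) *)
Definition phi (n : nat) (p q : 'I_n -> A) (k : 'I_(n + n)) : A :=
  match split k with inl i => p i | inr i => q i end.

(* the quadratic Hamiltonian of the statement *)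
Definition hamiltonian (n : nat) (mu kappa gamma : 'M[R]_n) (p q : 'I_n -> A) : A :=
  \sum_(i < n) \sum_(j < n)
    ( ((mu i j / 2)%:C) *: (p i * p j)
    + ((kappa i j / 2)%:C) *: (q i * q j)
    + ((gamma i j / 2)%:C) *: (p i * q j)
    + ((gamma j i / 2)%:C) *: (q i * p j)).

(* Dirac diagonalizability: there are d_i = sum_k c_ik phi_k with
   [d_i, d_j^dag] = delta_ij, [d_i, d_j] = 0 and real omega_i, Cst with
   H = sum_i omega_i d_i^dag d_i + Cst *)
Definition dirac_diagonalizable (adj : A -> A) (n : nat) (p q : 'I_n -> A) (H : A) : Prop :=
  exists (c : 'M[C]_(n, n + n)) (omega : 'I_n -> R) (Cst : R),
    let d := fun i : 'I_n => \sum_(k < n + n) c i k *: phi p q k in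
    [/\ forall i j, commr (d i) (adj (d j)) = (if i == j then 1 else 0),
        forall i j, commr (d i) (d j) = 0 &
        H = \sum_(i < n) (omega i)%:C *: (adj (d i) * d i) + (Cst%:C) *: 1].
End OpAlg.

(* M = [[mu, gamma], [gamma^T, kappa]] *)
Definition Mmat (n : nat) (mu kappa gamma : 'M[R]_n) : 'M[R]_(n + n) :=
  block_mx mu gamma gamma^T kappa.

(* Sigma_y = [[0, -i I], [i I, 0]] *)
Definition Sigma_y (n : nat) : 'M[C]_(n + n) :=
  block_mx 0 ((- 'i) *: 1%:M) ('i *: 1%:M) 0.

(* dynamic matrix D = Sigma_y M *)
Definition dynamic_matrix (n : nat) (mu kappa gamma : 'M[R]_n) : 'M[C]_(n + n) :=
  Sigma_y n *m map_mx (fun x : R => x%:C) (Mmat mu kappa gamma).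

(* diagonalizable over C and all eigenvalues real *)
Definition physically_diagonalizable (m : nat) (D : 'M[C]_m) : Prop :=
  diagonalizable D /\ (forall a : C, eigenvalue D a -> a \is Num.real).

End Defs.

(* Main.v *)
Require Import Defs.
From HB Require Import structures.
From mathcomp Require Import all_boot all_order all_algebra.
From mathcomp Require Import reals.
From mathcomp.real_closed Require Import complex.
Import Order.TTheory GRing.Theory Num.Theory.
Local Open Scope ring_scope.

(** Write J = Sigma_y, a Hermitian involution with conj J = J^T = -J, and
    D = J M. The operators d = X phi satisfy the canonical relations exactly
    when X J X^dag = 1 and X J X^T = 0, and H is a combination of the
    d_i^dag d_i up to a constant exactly when M = X^dag w X + X^T w conj X.
    Given the relations, the latter means X D = w X; the rows of X and conj X
    are then a basis of eigenvectors of D with eigenvalues w and -w.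

    Conversely, D is self-adjoint for the indefinite form <u, v> = u J v^dag.
    If k < n modes have been found, project an eigenbasis of D on the
    J-orthogonal complement of X and conj X, which commutes with D. The form
    is nondegenerate there and eigenvectors for distinct real eigenvalues are
    orthogonal, so polarization inside one eigenspace yields an eigenvector u
    with <u, u> <> 0. Since <conj u, conj u> = -<u, u>, <u, conj u> = 0 and
    conj u D = -l conj u, one of u and conj u, rescaled, is a new mode; no
    separate treatment of the eigenvalue 0 is needed. *)

Local Notation cj := (map_mx Num.conj).
Local Notation dag A := ((cj A)^T).

(** * Modes of the indefinite form [u *m J *m dag v], and how to add one more *)

Section Modes.
Set Implicit Arguments.
Unset Strict Implicit.
Variables (C : numClosedFieldType) (m : nat) (J M : 'M[C]_m).
Hypotheses (JT : J^T = - J) (Jcj : cj J = - J) (JJ : J *m J = 1%:M).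
Hypotheses (MT : M^T = M) (Mcj : cj M = M).

Lemma cjK a b (A : 'M[C]_(a, b)) : cj (cj A) = A.
Proof. by apply/matrixP => i j; rewrite !mxE conjCK. Qed.

Lemma cj_diag k (w : 'rV[C]_k) :
  (forall i, w 0 i \is Num.real) -> cj (diag_mx w) = diag_mx w.
Proof.
move=> wR; rewrite map_diag_mx; congr diag_mx.
by apply/rowP => i; rewrite mxE /= conj_Creal.
Qed.

Definition modes k (X : 'M[C]_(k, m)) : Prop :=
  X *m J *m dag X = 1%:M /\ X *m J *m X^T = 0.

(* For [modes X], [dual_modes X *m full_modes X] is the J-orthogonal projection
   on the span of the rows of [X] and [cj X]. *)
Definition full_modes k (X : 'M[C]_(k, m)) : 'M_(k + k, m) := col_mx X (cj X).
Definition dual_modes k (X : 'M[C]_(k, m)) : 'M_(m, k + k) :=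
  row_mx (J *m dag X) (- (J *m X^T)).

(** Conjugation negates [J], so the rows of [cj X] have norm -1; the minus sign in [dual_modes]
    makes up for it. *)
Lemma mul_full_dual k (X : 'M[C]_(k, m)) :
  modes X -> full_modes X *m dual_modes X = 1%:M.
Proof.
move=> [X1 X0]; rewrite mul_col_row !mulmxN !mulmxA X1 X0 oppr0.
have X0' : cj X *m J *m dag X = 0.
  by rewrite -[J]opprK -Jcj mulmxN mulNmx map_trmx -!map_mxM X0 map_mx0 oppr0.
have X1' : cj X *m J *m X^T = - 1%:M.
  rewrite -[J]opprK -Jcj mulmxN mulNmx -[X in _ *m _ *m X^T]cjK.
  by rewrite map_trmx -!map_mxM X1 map_mx1.
by rewrite X0' X1' opprK -scalar_mx_block.
Qed.

Lemma conj_eigenrows k (X : 'M[C]_(k, m)) (w : 'rV[C]_k) :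
  (forall i, w 0 i \is Num.real) -> X *m (J *m M) = diag_mx w *m X ->
  cj X *m (J *m M) = - (diag_mx w *m cj X).
Proof.
move=> wR XD; rewrite -(cj_diag wR) -map_mxM -XD !map_mxM Jcj Mcj.
by rewrite mulNmx mulmxN opprK.
Qed.

(** [J] is Hermitian and [M] real symmetric, so the dagger of [J *m M] is [M *m J]: this is
    self-adjointness for the form. *)
Lemma dag_eigenrows k (X : 'M[C]_(k, m)) (w : 'rV[C]_k) :
  (forall i, w 0 i \is Num.real) -> X *m (J *m M) = diag_mx w *m X ->
  M *m J *m dag X = dag X *m diag_mx w.
Proof.
move=> wR XD; rewrite -[in RHS](tr_diag_mx w) -[in RHS](cj_diag wR).
rewrite -trmx_mul -map_mxM -XD !map_mxM !trmx_mul Jcj Mcj MT linearN /= JT.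
by rewrite opprK.
Qed.

Lemma full_eigenrows k (X : 'M[C]_(k, m)) (w : 'rV[C]_k) :
  (forall i, w 0 i \is Num.real) -> X *m (J *m M) = diag_mx w *m X ->
  full_modes X *m (J *m M) = diag_mx (row_mx w (- w)) *m full_modes X.
Proof.
move=> wR XD; rewrite diag_mx_row mul_block_col !mul0mx addr0 add0r.
by rewrite mul_col_mx XD (conj_eigenrows wR XD) linearN /= mulNmx.
Qed.

(** Together with [full_eigenrows], this makes the projection [dual_modes X *m full_modes X] commute
    with [J *m M]. *)
Lemma dual_eigencols k (X : 'M[C]_(k, m)) (w : 'rV[C]_k) :
  (forall i, w 0 i \is Num.real) -> X *m (J *m M) = diag_mx w *m X ->
  (J *m M) *m dual_modes X = dual_modes X *m diag_mx (row_mx w (- w)).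
Proof.
move=> wR XD; rewrite diag_mx_row mul_row_block !mulmx0 addr0 add0r.
(* [X^T] is rewritten as the dagger of [cj X], whose rows have eigenvalues [- w]. *)
rewrite mul_mx_row -[X^T](congr1 trmx (cjK X)) !mulmxN -!mulmxA.
rewrite [M *m (J *m dag X)]mulmxA (dag_eigenrows wR XD) linearN /= mulmxN.
have XcD : cj X *m (J *m M) = diag_mx (- w) *m cj X.
  by rewrite linearN mulNmx (conj_eigenrows wR XD).
have wNR i : (- w) 0 i \is Num.real by rewrite mxE rpredN.
rewrite [M *m (J *m dag (cj X))]mulmxA (dag_eigenrows wNR XcD).
by rewrite linearN /= !(mulmxN, mulNmx) !opprK !mulmxA.
Qed.


Lemma dag_form a b (U : 'M[C]_(a, m)) (V : 'M[C]_(b, m)) :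
  dag (U *m J *m dag V) = V *m J *m dag U.
Proof.
rewrite !map_mxM map_trmx cjK !trmx_mul trmxK Jcj linearN /= JT opprK.
by rewrite mulmxA.
Qed.

Lemma cj_form a b (U : 'M[C]_(a, m)) (V : 'M[C]_(b, m)) :
  cj U *m J *m dag (cj V) = - cj (U *m J *m dag V).
Proof. by rewrite !map_mxM Jcj mulmxN mulNmx opprK map_trmx. Qed.

Lemma tr_form a b (U : 'M[C]_(a, m)) (V : 'M[C]_(b, m)) :
  V *m J *m U^T = - (U *m J *m V^T)^T.
Proof. by rewrite !trmx_mul trmxK JT mulNmx mulmxN opprK mulmxA. Qed.

Definition extends_modes k (X : 'M[C]_(k, m)) (u : 'rV[C]_m) (l : C) : Prop :=
  [/\ l \is Num.real, u *m (J *m M) = l *: u, u *m J *m dag u = 1%:M,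
      X *m J *m dag u = 0 & X *m J *m u^T = 0].

Lemma normalize_positive_mode k (X : 'M[C]_(k, m)) (u : 'rV[C]_m) (l : C) :
  l \is Num.real -> u *m (J *m M) = l *: u ->
  X *m J *m dag u = 0 -> X *m J *m u^T = 0 -> 0 < (u *m J *m dag u) 0 0 ->
  exists v, extends_modes X v l.
Proof.
move=> lR uD Xu Xut r_gt0; set r := _ 0 0 in r_gt0.
have s_gt0 : 0 < sqrtC r by rewrite sqrtC_gt0.
have sR : ((sqrtC r)^-1)^* = (sqrtC r)^-1.
  by rewrite conj_Creal // rpredV gtr0_real.
exists ((sqrtC r)^-1 *: u); split => //.
- by rewrite -scalemxAl uD !scalerA mulrC.
- rewrite map_mxZ /= sR linearZ /= -!scalemxAl -scalemxAr scalerA.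
  rewrite [_ *m dag u]mx11_scalar -/r scale_scalar_mx; congr _%:M.
  by rewrite -invfM -expr2 sqrtCK mulVf // gt_eqF.
- by rewrite map_mxZ linearZ /= -scalemxAr Xu scaler0.
- by rewrite linearZ /= -scalemxAr Xut scaler0.
Qed.

Lemma normalize_mode k (X : 'M[C]_(k, m)) (u : 'rV[C]_m) (l : C) :
  l \is Num.real -> u *m (J *m M) = l *: u -> u *m dual_modes X = 0 ->
  (u *m J *m dag u) 0 0 != 0 -> exists v l', extends_modes X v l'.
Proof.
move=> lR uD; rewrite mul_mx_row mulmxN !mulmxA -[0]row_mx0 => /eq_row_mx[].
move=> uX /eqP; rewrite oppr_eq0 => /eqP uXt r_neq0.
have Xu : X *m J *m dag u = 0 by rewrite -dag_form uX map_mx0 trmx0.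
have Xut : X *m J *m u^T = 0 by rewrite tr_form uXt trmx0 oppr0.
have rcj : ((u *m J *m dag u) 0 0)^* = (u *m J *m dag u) 0 0.
  by rewrite -[in RHS]dag_form !mxE.
have /CrealP := rcj; move=> /real_neqr_lt-/(_ _ (real0 _)); rewrite r_neq0 => /esym/orP[r_lt0|r_gt0].
(* Negative norm: passing to [cj u] flips the sign of norm and eigenvalue and swaps the two
   orthogonality conditions. *)
- have [|||||v Xv] := @normalize_positive_mode k X (cj u) (- l).
  + by rewrite rpredN.
  + have := @conj_eigenrows 1 u (const_mx l).
    rewrite diag_const_mx !mul_scalar_mx scaleNr; apply => // i.
    by rewrite mxE.
  + by rewrite cjK.
  + by [].
  + by rewrite cj_form mxE [X in - X]mxE rcj oppr_gt0.
  by exists v, (- l).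
- by have [v Xv] := normalize_positive_mode lR uD Xu Xut r_gt0; exists v, l.
Qed.

(** The Gram matrix of the rows of [U] commutes with [diag_mx d], so a nonzero entry joins two rows
    of equal eigenvalue. One of these rows, or a combination of both, has nonzero norm. *)
Lemma nonisotropic_eigenvector (U : 'M[C]_m) (d : 'rV[C]_m) :
  (forall i, d 0 i \is Num.real) -> U *m (J *m M) = diag_mx d *m U ->
  U *m J *m dag U != 0 ->
  exists (x u : 'rV[C]_m) (l : C), [/\ l \is Num.real, u = x *m U,
    u *m (J *m M) = l *: u & (u *m J *m dag u) 0 0 != 0].
Proof.
move=> dR UD /matrix0Pn[j [k]]; set G := _ *m dag U => Gjk.
have Gsym : G *m diag_mx d = diag_mx d *m G.
  rewrite /G -mulmxA -(dag_eigenrows dR UD) -mulmxA !mulmxA.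
  by rewrite -UD -!mulmxA.
have djk : d 0 j = d 0 k.
  move/matrixP/(_ j k): Gsym; rewrite mul_mx_diag mul_diag_mx mxE [RHS]mxE => /eqP.
  by rewrite mulrC -subr_eq0 -mulrBl mulf_eq0 (negPf Gjk) orbF subr_eq0 => /eqP.
have formE (x y : 'rV[C]_m) : (x *m U) *m J *m dag (y *m U) = x *m G *m dag y.
  by rewrite /G map_mxM trmx_mul !mulmxA.
have Gdag : dag G = G by rewrite /G dag_form.
have eig (x : 'rV[C]_m) : x *m diag_mx d = d 0 j *: x ->
    (x *m G *m dag x) 0 0 != 0 ->
  exists (x u : 'rV[C]_m) (l : C), [/\ l \is Num.real, u = x *m U,
    u *m (J *m M) = l *: u & (u *m J *m dag u) 0 0 != 0].
  move=> xd xG; exists x, (x *m U), (d 0 j); split => //.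
  - by rewrite -mulmxA UD mulmxA xd scalemxAl.
  - by rewrite formE.
have dE i : d 0 i = d 0 j ->
    ('e_i : 'rV[C]_m) *m diag_mx d = d 0 j *: 'e_i.
  move=> <-; rewrite -rowE; apply/rowP => l; rewrite !mxE eqxx /= eq_sym.
  by rewrite mulr_natr.
have GE i l : (('e_i : 'rV[C]_m) *m G *m dag ('e_l : 'rV[C]_m)) 0 0 = G i l.
  by rewrite map_delta_mx trmx_delta -rowE -colE !mxE.
have [Gj0|Gj] := eqVneq (G j j) 0; last first.
  by apply: (eig 'e_j); rewrite ?GE ?dE.
have [Gk0|Gk] := eqVneq (G k k) 0; last first.
  by apply: (eig 'e_k); rewrite ?GE ?dE.
(* The diagonal entries vanish, so this vector has norm [2 |G j k|^2]. *)
apply: (eig ('e_j + G j k *: 'e_k)).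
  by rewrite mulmxDl -scalemxAl !dE // scalerDr !scalerA mulrC.
rewrite map_mxD linearD /= map_mxZ linearZ /= !mulmxDl !mulmxDr.
rewrite -!scalemxAl -!scalemxAr.
have Gkj : G k j = (G j k)^* by rewrite -[in LHS]Gdag !mxE.
have addE (A B : 'M[C]_1) : (A + B) 0 0 = A 0 0 + B 0 0 by rewrite mxE.
have scaleE a (A : 'M[C]_1) : (a *: A) 0 0 = a * A 0 0 by rewrite mxE.
rewrite !addE !scaleE !GE Gj0 Gk0 Gkj !mulr0 add0r addr0 [_^* * _]mulrC.
by rewrite -mulr2n mulrn_eq0 /= mulf_eq0 conjC_eq0 (negPf Gjk).
Qed.

Lemma extend_modes k (X : 'M[C]_(k, m)) (w : 'rV[C]_k) :
  modes X -> (forall i, w 0 i \is Num.real) ->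
  X *m (J *m M) = diag_mx w *m X -> (k + k < m)%N ->
  diagonalizable (J *m M) ->
  (forall a, eigenvalue (J *m M) a -> a \is Num.real) ->
  exists u l, extends_modes X u l.
Proof.
move=> Xm wR XD km [P Pu /similar_diagPex[d /(similarP Pu) Pd]] eigR.
(* A row of the invertible [P] is nonzero, so each [d 0 i] is an eigenvalue. *)
have dR i : d 0 i \is Num.real.
  apply: eigR; apply/eigenvalueP; exists (row i P).
    by rewrite -row_mul Pd row_mul row_diag_mx -scalemxAl -rowE.
  apply/eqP => Pi; have : row i P *m invmx P = 0 by rewrite Pi mul0mx.
  rewrite -row_mul mulmxV // => /rowP/(_ i)/eqP.
  by rewrite !mxE eqxx oner_eq0.
pose S := full_modes X; pose T := dual_modes X; pose pi := 1%:M - T *m S.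
have ST : S *m T = 1%:M by apply: mul_full_dual.
have piT : pi *m T = 0.
  by rewrite mulmxBl mul1mx -mulmxA ST mulmx1 subrr.
have piD : pi *m (J *m M) = J *m M *m pi.
  rewrite mulmxBl mulmxBr mul1mx mulmx1; congr (_ - _).
  rewrite -[LHS]mulmxA (full_eigenrows wR XD) [RHS]mulmxA.
  by rewrite (dual_eigencols wR XD) mulmxA.
have piJS : pi *m J *m dag S = 0.
  move: piT; rewrite mul_mx_row mulmxN -[0]row_mx0 => /eq_row_mx[pi1 /eqP].
  rewrite oppr_eq0 => /eqP pi2; rewrite map_col_mx tr_col_mx mul_mx_row.
  by rewrite cjK -!mulmxA pi1 pi2 row_mx0.
(* [T *m S] factors through dimension [k + k < m], so it is not the identity. *)
have pi_neq0 : pi != 0.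
  apply: contraTneq km => /subr0_eq TS1.
  rewrite -leqNgt -(mxrank1 C m) TS1.
  exact: leq_trans (mxrankM_maxl _ _) (rank_leq_col _).
have UD : P *m pi *m (J *m M) = diag_mx d *m (P *m pi).
  by rewrite -mulmxA piD !mulmxA -[P *m J *m M]mulmxA Pd.
have [|x [u [l [lR uE uD u_neq0]]]] := nonisotropic_eigenvector dR UD.
  apply: contra_neq pi_neq0 => U0.
  have : pi *m J *m dag pi = 0.
    rewrite map_mxM trmx_mul !mulmxA in U0.
    move/(congr1 (fun A => invmx P *m A)): U0; rewrite !mulmxA mulVmx //.
    rewrite mul1mx mulmx0 => /(congr1 (fun A => A *m invmx (dag P))).
    by rewrite mulmxK ?mul0mx // unitmx_tr map_unitmx.
  rewrite {2}/pi map_mxB linearB /= map_mx1 trmx1 mulmxBr mulmx1.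
  rewrite map_mxM trmx_mul mulmxA piJS mul0mx subr0.
  by move/(congr1 (fun A => A *m J)); rewrite -mulmxA JJ mulmx1 mul0mx.
apply: normalize_mode lR uD _ u_neq0.
by rewrite uE -!mulmxA piT !mulmx0.
Qed.

End Modes.

(** * Complete systems of [n] modes and the diagonalization of [J *m M] *)

Section CompleteModes.
Set Implicit Arguments.
Unset Strict Implicit.
Variables (C : numClosedFieldType) (n : nat) (J M : 'M[C]_(n + n)).
Hypotheses (JT : J^T = - J) (Jcj : cj J = - J) (JJ : J *m J = 1%:M).
Hypotheses (MT : M^T = M) (Mcj : cj M = M).

Lemma exists_modes k :
  diagonalizable (J *m M) ->
  (forall a, eigenvalue (J *m M) a -> a \is Num.real) -> (k <= n)%N ->
  exists (X : 'M[C]_(k, n + n)) (w : 'rV[C]_k),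
    [/\ modes J X, forall i, w 0 i \is Num.real &
        X *m (J *m M) = diag_mx w *m X].
Proof.
move=> diagD realD; elim: k => [_|k IHk lt_kn].
  exists 0, 0; split; last by rewrite mul0mx mulmx0.
    by split; apply/matrixP => -[].
  by case.
have [X [w [Xm wR XD]]] := IHk (ltnW lt_kn).
have kkn : (k + k < n + n)%N by rewrite -addSn leq_add // ltnW.
have [u [l [lR uD u1 Xu Xut]]] :=
  extend_modes JT Jcj JJ MT Mcj Xm wR XD kkn diagD realD.
have [X1 X0] := Xm.
(* The size is written [1 + k], convertible to [k.+1], so that [col_mx u X] fits. *)
suff: exists (X : 'M[C]_(1 + k, n + n)) (w : 'rV[C]_(1 + k)),
    [/\ modes J X, forall i, w 0 i \is Num.real &
        X *m (J *m M) = diag_mx w *m X] by [].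
exists (col_mx u X), (row_mx l%:M w); split.
- split.
  + rewrite map_col_mx tr_col_mx mul_mx_row !mul_col_mx u1 X1 Xu.
    rewrite -(dag_form JT Jcj) Xu map_mx0 trmx0.
    by rewrite -block_mxEh -scalar_mx_block.
  + rewrite tr_col_mx mul_mx_row !mul_col_mx X0 Xut.
    rewrite (tr_form JT X u) Xut.
    rewrite trmx0 oppr0.
    (* [J] is antisymmetric, so this entry is its own opposite. *)
    have -> : u *m J *m u^T = 0.
      apply/matrixP => i j; rewrite !ord1 [RHS]mxE.
      have /matrixP/(_ 0 0) := tr_form JT u u.
      by rewrite [RHS]mxE [X in - X]mxE => /eqP; rewrite -addr_eq0 -mulr2n mulrn_eq0 => /eqP.
    by rewrite !col_mx0 row_mx0.
- move=> i; rewrite mxE; case: split => j; last exact: wR.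
  by rewrite !ord1 mxE mulr1n.
- rewrite mul_col_mx uD XD diag_mx_row mul_block_col !mul0mx addr0 add0r.
  congr col_mx; apply/rowP => i; rewrite mul_diag_mx !mxE.
  by rewrite mulr1n.
Qed.

(** With [n] modes [full_modes X] is square, so its right inverse is also a left inverse. Inserting
    their product in [J *m (J *m M)] brings out the eigenvalues [w] and [- w], and the minus sign of
    [- w] cancels that of [dual_modes]. *)
Lemma modes_decomposition (X : 'M[C]_(n, n + n)) (w : 'rV[C]_n) :
  modes J X -> (forall i, w 0 i \is Num.real) ->
  X *m (J *m M) = diag_mx w *m X ->
  M = dag X *m diag_mx w *m X + X^T *m diag_mx w *m cj X.
Proof.
move=> Xm wR XD.
have TS := mulmx1C (mul_full_dual Jcj Xm).
rewrite -[LHS]mul1mx -JJ -mulmxA -[J *m M]mul1mx -TS -(mulmxA _ _ (J *m M)).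
rewrite (full_eigenrows Jcj Mcj wR XD).
rewrite diag_mx_row mul_block_col !mul0mx addr0 add0r mul_row_col.
rewrite linearN /= mulmxDr !(mulNmx, mulmxN) opprK !mulmxA JJ.
by rewrite !mul1mx.
Qed.

Lemma decomposition_eigenrows (X : 'M[C]_(n, n + n)) (w : 'rV[C]_n) :
  modes J X ->
  M = dag X *m diag_mx w *m X + X^T *m diag_mx w *m cj X ->
  X *m (J *m M) = diag_mx w *m X.
Proof.
move=> [X1 X0] ->; rewrite !mulmxDr !mulmxA X1 X0 mul1mx !mul0mx.
by rewrite addr0.
Qed.

Lemma modes_diagonalize (X : 'M[C]_(n, n + n)) (w : 'rV[C]_n) :
  modes J X -> (forall i, w 0 i \is Num.real) ->
  X *m (J *m M) = diag_mx w *m X ->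
  diagonalizable (J *m M) /\
  (forall a, eigenvalue (J *m M) a -> a \is Num.real).
Proof.
move=> Xm wR XD.
have ST := mul_full_dual Jcj Xm.
have SD := full_eigenrows Jcj Mcj wR XD.
set S := full_modes _ in ST SD; set T := dual_modes _ _ in ST.
set W := row_mx w _ in SD.
have WR i : W 0 i \is Num.real.
  by rewrite mxE; case: split => j; rewrite ?mxE ?rpredN.
have [Su Tu] := mulmx1_unit ST.
split.
  by exists S => //; apply/similar_diagPex; exists W; apply/similarP.
move=> a /eigenvalueP[v vD v_neq0].
(* In the coordinates given by [T], [v] is an eigenvector of [diag_mx W], so its eigenvalue is an
   entry of [W]. *)
have vT_neq0 : v *m T != 0.
  apply: contra_neq v_neq0 => vT0.
  by rewrite -[v]mulmx1 -(mulmx1C ST) mulmxA vT0 mul0mx.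
have vTW : v *m T *m diag_mx W = a *: (v *m T).
  rewrite scalemxAl -vD -!mulmxA; congr (v *m _).
  rewrite !mulmxA -[RHS](mul1mx (J *m M *m T)) -(mulmx1C ST) -!mulmxA.
  by congr (_ *m _); rewrite !mulmxA -[S *m J *m M]mulmxA SD -mulmxA ST mulmx1.
have /rV0Pn[i vTi] := vT_neq0.
move/rowP/(_ i): vTW; rewrite mul_mx_diag mxE [RHS]mxE mulrC.
by move/(mulIf vTi) <-.
Qed.

End CompleteModes.

(** * Quadratic expressions in generators whose commutators are scalars *)

Section QuadraticForms.
Set Implicit Arguments.
Unset Strict Implicit.
Variables (C : numClosedFieldType) (A : algType C) (m : nat).
Variables (J : 'M[C]_m) (f : 'I_m -> A).
Hypothesis fJ : forall a b, f a * f b - f b * f a = J a b *: 1.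

Definition lin k (X : 'M[C]_(k, m)) (i : 'I_k) : A := \sum_a X i a *: f a.
Definition quad (N : 'M[C]_m) : A := \sum_a \sum_b N a b *: (f a * f b).

(** The algebra has [1 != 0]; this lets commutator identities be read as matrix identities. *)
Lemma scale_one_inj : injective (fun x : C => x *: (1 : A)).
Proof.
move=> x y /eqP; rewrite -subr_eq0 -scalerBl scaler_eq0 oner_eq0 orbF.
by rewrite subr_eq0 => /eqP.
Qed.

Lemma lin_mul k l (X : 'M[C]_(k, m)) (Y : 'M[C]_(l, m)) i j :
  lin X i * lin Y j = \sum_a \sum_b (X i a * Y j b) *: (f a * f b).
Proof.
rewrite mulr_suml; apply: eq_bigr => a _; rewrite mulr_sumr.
by apply: eq_bigr => b _; rewrite -scalerAl -scalerAr scalerA.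
Qed.

Lemma lin_comm k l (X : 'M[C]_(k, m)) (Y : 'M[C]_(l, m)) i j :
  lin X i * lin Y j - lin Y j * lin X i = (X *m J *m Y^T) i j *: 1.
Proof.
have -> : lin Y j * lin X i = \sum_a \sum_b (X i a * Y j b) *: (f b * f a).
  rewrite lin_mul exchange_big; apply: eq_bigr => a _.
  by apply: eq_bigr => b _; rewrite mulrC.
rewrite lin_mul -sumrB mxE scaler_suml.
under eq_bigr => a _ do rewrite -sumrB.
rewrite exchange_big; apply: eq_bigr => b _ /=.
rewrite !mxE mulr_suml scaler_suml; apply: eq_bigr => a _.
by rewrite -scalerBr fJ scalerA mulrAC.
Qed.

Lemma quad_lin k (X Y : 'M[C]_(k, m)) (w : 'rV[C]_k) :
  \sum_i w 0 i *: (lin Y i * lin X i) = quad (Y^T *m diag_mx w *m X).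
Proof.
under eq_bigr => i _ do rewrite lin_mul scaler_sumr.
rewrite exchange_big; apply: eq_bigr => a _ /=.
under eq_bigr => i _ do rewrite scaler_sumr.
rewrite exchange_big; apply: eq_bigr => b _ /=.
rewrite !mxE scaler_suml; apply: eq_bigr => i _.
by rewrite mul_mx_diag !mxE scalerA mulrCA mulrA.
Qed.

Lemma quadD N N' : quad (N + N') = quad N + quad N'.
Proof.
rewrite -big_split; apply: eq_bigr => a _; rewrite -big_split.
by apply: eq_bigr => b _; rewrite mxE scalerDl.
Qed.

Lemma quadZ x N : quad (x *: N) = x *: quad N.
Proof.
rewrite scaler_sumr; apply: eq_bigr => a _; rewrite scaler_sumr.
by apply: eq_bigr => b _; rewrite mxE scalerA.
Qed.

(** Exchanging [f a] and [f b] costs the scalar [J a b]; these costs add up to the trace. *)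
Lemma quad_tr N : quad N^T = quad N - \tr (N *m J^T) *: 1.
Proof.
rewrite /quad exchange_big scaler_suml -sumrB; apply: eq_bigr => a _ /=.
rewrite !mxE scaler_suml -sumrB; apply: eq_bigr => b _.
by rewrite !mxE -scalerA -fJ -scalerBr opprB addrC subrK.
Qed.

(** The zero-point energy comes from here: symmetrizing an ordered product leaves a scalar. *)
Lemma quad_sym N :
  quad (2^-1 *: (N + N^T)) = quad N - (2^-1 * \tr (N *m J^T)) *: 1.
Proof.
rewrite quadZ quadD quad_tr addrA scalerBr scalerA -mulr2n -scaler_nat scalerA.
by rewrite mulVf ?pnatr_eq0 // scale1r.
Qed.

Lemma quad_scalar_eq0 N x : J *m J = 1%:M -> J^T = - J ->
  quad N = x *: 1 -> N + N^T = 0.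
Proof.
move=> JJ JT Nx.
(* The double commutator with [f c] and [f e] is the scalar
   [(J *m (N + N^T) *m J) c e]. *)
have comm1 c : f c * quad N - quad N * f c = lin (J *m (N + N^T)) c.
  rewrite mulr_sumr mulr_suml -sumrB mulmxDr.
  transitivity (\sum_a \sum_b (N a b *: (J c a *: f b) + N a b *: (J c b *: f a))).
    apply: eq_bigr => a _; rewrite mulr_sumr mulr_suml -sumrB.
    apply: eq_bigr => b _; rewrite -scalerAr -scalerAl -scalerBr -scalerDr.
    congr (_ *: _); rewrite -[J c a *: _]mulr_algl -[J c b *: _]mulr_algr -!fJ.
    by rewrite mulrBl mulrBr !mulrA addrA subrK.
  under eq_bigr => a _ do rewrite big_split.
  rewrite big_split exchange_big -big_split; apply: eq_bigr => b _ /=.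
  rewrite !mxE scalerDl !scaler_suml; congr (_ + _).
    by apply: eq_bigr => a _; rewrite scalerA mulrC.
  by apply: eq_bigr => a _; rewrite scalerA mxE mulrC.
have : J *m (N + N^T) *m J = 0.
  apply/matrixP => c e; apply: scale_one_inj => /=.
  have := lin_comm (J *m (N + N^T)) 1%:M c e.
  rewrite trmx1 mulmx1 => <-; rewrite -comm1 Nx -scalerAl -scalerAr mul1r mulr1.
  by rewrite subrr mul0r mulr0 subrr mxE scale0r.
move/(congr1 (fun A => J *m A *m J)); rewrite !mulmxA JJ mul1mx -mulmxA JJ.
by rewrite mulmx1 mulmx0 mul0mx.
Qed.

End QuadraticForms.

(** * The case of [Sigma_y] and the generators [phi] *)

Section PhaseSpace.
Set Implicit Arguments.
Unset Strict Implicit.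
Variables (R : realType) (n : nat).
Local Notation C := R[i].

Lemma tr_Sigma_y : (Sigma_y R n)^T = - Sigma_y R n.
Proof.
rewrite tr_block_mx !trmx0 opp_block_mx !oppr0 !linearZ /= trmx1.
by rewrite !scalerN !scaleNr opprK.
Qed.

Lemma cj_Sigma_y : cj (Sigma_y R n) = - Sigma_y R n.
Proof.
rewrite map_block_mx !map_mx0 opp_block_mx !oppr0 !map_mxZ map_mx1.
by rewrite /= rmorphN /= conjCi -!scaleNr.
Qed.

Lemma Sigma_y_sqr : Sigma_y R n *m Sigma_y R n = 1%:M.
Proof.
rewrite mulmx_block !mul0mx !mulmx0 !addr0 !add0r -!scalemxAl -!scalemxAr.
rewrite !scalerA !mulmx1 mulNr mulrN -expr2 sqrCi opprK !scale1r.
by rewrite -scalar_mx_block.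
Qed.

Lemma tr_Mmat (mu kappa gamma : 'M[R]_n) : mu^T = mu -> kappa^T = kappa ->
  (Mmat mu kappa gamma)^T = Mmat mu kappa gamma.
Proof. by move=> muT kappaT; rewrite tr_block_mx muT kappaT trmxK. Qed.

Lemma cj_map_real k l (N : 'M[R]_(k, l)) :
  cj (map_mx (real_complex R) N) = map_mx (real_complex R) N.
Proof. by apply/matrixP => i j; rewrite !mxE; apply: conjc_real. Qed.

Variables (A : algType C) (p q : 'I_n -> A).

Lemma phi_comm : CCR p q ->
  forall a b, phi p q a * phi p q b - phi p q b * phi p q a
              = Sigma_y R n a b *: 1.
Proof.
move=> [pq pp qq] a b; rewrite /phi /Sigma_y !mxE.
case: (split a) => i; rewrite !mxE; case: (split b) => j; rewrite !mxE.
- by rewrite scale0r; apply: pp.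
- rewrite [LHS]pq; congr (_ *: _).
  by case: eqP => _; rewrite ?mulr1 ?mulr0.
- rewrite -opprB [X in - X]pq eq_sym -scaleNr; congr (_ *: _).
  by case: eqP => _; rewrite ?opprK ?oppr0 ?mulr1 ?mulr0.
- by rewrite scale0r; apply: qq.
Qed.

Lemma hamiltonian_quad (mu kappa gamma : 'M[R]_n) :
  hamiltonian mu kappa gamma p q =
  quad (phi p q) (2^-1 *: map_mx (real_complex R) (Mmat mu kappa gamma)).
Proof.
have phil i : phi p q (lshift n i) = p i by rewrite /phi (unsplitK (inl i)).
have phir i : phi p q (rshift n i) = q i by rewrite /phi (unsplitK (inr i)).
have half (x : R) : (x / 2)%:C%C = 2^-1 * x%:C%C :> C.
  by rewrite rmorphM fmorphV rmorph_nat mulrC.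
rewrite /quad big_split_ord /= -big_split; apply: eq_bigr => i _ /=.
rewrite !big_split_ord /= -!big_split; apply: eq_bigr => j _ /=.
have ME a b (N : 'M[R]_(n + n)) :
    (2^-1 *: map_mx (real_complex R) N) a b = 2^-1 * (N a b)%:C%C.
  by rewrite 2!mxE.
rewrite !phil !phir !ME !half.
rewrite /Mmat block_mxEul block_mxEur block_mxEdl block_mxEdr mxE.
by rewrite -!addrA; congr (_ + _); rewrite addrC -addrA.
Qed.

Lemma adj_lin (adj : A -> A) k (X : 'M[C]_(k, n + n)) i :
  is_adjoint adj ->
  (forall i, is_hermitian adj (p i)) -> (forall i, is_hermitian adj (q i)) ->
  adj (lin (phi p q) X i) = lin (phi p q) (cj X) i.
Proof.
move=> [adjD adjZ _ _] adjp adjq.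
have adj0 : adj 0 = 0 by rewrite -[0 in LHS](scale0r 0) adjZ conjc0 scale0r.
rewrite (big_morph adj adjD adj0); apply: eq_bigr => a _.
by rewrite adjZ mxE /phi; congr (_ *: _); case: split.
Qed.

End PhaseSpace.

(** * Passage between operator identities and matrix identities *)

Theorem theorem5 (R : realType) (A : algType R[i]) (adj : A -> A)
  (n : nat) (mu kappa gamma : 'M[R]_n) (p q : 'I_n -> A) :
  is_adjoint adj ->
  (forall i, is_hermitian adj (p i)) -> (forall i, is_hermitian adj (q i)) ->
  CCR p q ->
  mu^T = mu -> kappa^T = kappa ->
  dirac_diagonalizable adj p q (hamiltonian mu kappa gamma p q)
  <-> physically_diagonalizable (dynamic_matrix mu kappa gamma).
Proof.
move=> adjP adjp adjq pqP muT kappaT.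
set f := phi p q; set J := Sigma_y R n.
set M := map_mx (real_complex R) (Mmat mu kappa gamma).
have fJ : forall a b, f a * f b - f b * f a = J a b *: 1 := phi_comm pqP.
have JT : J^T = - J := tr_Sigma_y R n.
have Jcj : cj J = - J := cj_Sigma_y R n.
have JJ : J *m J = 1%:M := Sigma_y_sqr R n.
have MT : M^T = M by rewrite map_trmx tr_Mmat.
have Mcj : cj M = M := cj_map_real _.
have adj_f k (X : 'M[R[i]]_(k, n + n)) i : adj (lin f X i) = lin f (cj X) i.
  exact: adj_lin.
have realC (x : R) : x%:C%C \is Num.real by apply/CrealP; apply: conjc_real.
rewrite hamiltonian_quad -/f -/M; split.
- move=> [X [om [c]]] /= [dd d0 HE].
  pose w : 'rV_n := \row_i (om i)%:C%C.
  have wR i : w 0 i \is Num.real by rewrite mxE realC.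
  have Xm : modes J X.
    split; apply/matrixP => i j; apply: (@scale_one_inj _ A) => /=.
      rewrite -(lin_comm fJ) -adj_f [LHS]dd mxE.
      by case: eqP; rewrite ?scale1r ?scale0r.
    by rewrite -(lin_comm fJ) [LHS]d0 mxE scale0r.
  pose G := dag X *m diag_mx w *m X.
  have HG : quad f (2^-1 *: M) = quad f G + c%:C%C *: 1.
    rewrite HE -quad_lin; congr (_ + _); apply: eq_bigr => i _.
    by rewrite mxE -adj_f.
  (* An operator fixes its coefficients only up to an antisymmetric part, so symmetric parts are
     compared: [M] is symmetric, hence equal to [G + G^T]. *)
  have /(quad_scalar_eq0 fJ JJ JT) : quad f (2^-1 *: M + -1 *: G) = c%:C%C *: 1.
    by rewrite quadD HG quadZ scaleN1r addrAC subrr add0r.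
  rewrite scaleN1r linearB linearZ /= MT addrACA -opprD -scalerDl => /subr0_eq.
  have -> : 2^-1 + 2^-1 = 1 :> R[i].
    by rewrite -mulr2n -[LHS]mulr_natr mulVf ?pnatr_eq0.
  rewrite scale1r {2}/G !trmx_mul trmxK tr_diag_mx mulmxA => MG.
  exact: (modes_diagonalize Jcj Mcj Xm wR (decomposition_eigenrows Xm MG)).
- move=> [diagD realD].
  have [X [w [Xm wR XD]]] := exists_modes JT Jcj JJ MT Mcj diagD realD (leqnn n).
  have MG := modes_decomposition Jcj JJ Mcj Xm wR XD.
  have [X1 X0] := Xm.
  pose om i := complex.Re (w 0 i).
  have omE i : (om i)%:C%C = w 0 i by apply: RRe_real.
  (* The constant is half the sum of the frequencies, left over when [G] is symmetrized. *)
  exists X, om, (2^-1 * \sum_i om i) => /=; split.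
  + move=> i j; rewrite -/(lin f X i) -/(lin f X j) adj_f [LHS](lin_comm fJ) X1.
    by rewrite mxE; case: eqP; rewrite ?scale1r ?scale0r.
  + by move=> i j; rewrite [LHS](lin_comm fJ) X0 mxE scale0r.
  + pose G := dag X *m diag_mx w *m X.
    have GT : X^T *m diag_mx w *m cj X = G^T.
      by rewrite !trmx_mul trmxK tr_diag_mx mulmxA.
    transitivity (quad f G + (2^-1 * \sum_i w 0 i) *: 1); last first.
      congr (_ + _ *: _).
        rewrite -quad_lin; apply: eq_bigr => i _.
        by rewrite omE -adj_f.
      rewrite rmorphM fmorphV rmorph_nat rmorph_sum; congr (_ * _).
      by apply: eq_bigr => i _; rewrite -omE.
    (* Cycling the trace brings out [X *m J *m dag X = 1], which leaves the trace of [diag_mx w]. *)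
    have trG : \tr (G *m J^T) = - \sum_i w 0 i.
      rewrite JT mulmxN linearN /= /G -!mulmxA mxtrace_mulC -!mulmxA.
      by rewrite [X *m (J *m _)]mulmxA X1 mulmx1 mxtrace_diag.
    by rewrite MG GT (quad_sym fJ) trG mulrN scaleNr opprK.
Qed.
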